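(* Let $d\ge2$ be an integer. For all real $p,n$ with $p\ge n>d/2$ one has $$K_{pn}\ge K^{[-]}_p,\qquad K^{[-]}_p:=\frac{U_d}{(2\pi)^{d/2}}\,2^{p/2},$$ where $U_d:=1$ if $d\ge3$ and $U_d:=1/\sqrt2$ if $d=2$.
   Context: Notation. $\mathbf T^d=(\mathbf R/2\pi\mathbf Z)^d$; $e_k(x)=(2\pi)^{-d/2}e^{ik\cdot x}$ for $k\in\mathbf Z^d$; $a\cdot b=\sum_ra_rb_r$ and $|a|=\sqrt{\overline a\cdot a}$ on $\mathbf C^d$; $\mathbf Z^d_0=\mathbf Z^d\setminus\{0\}$. An $\mathbf R^d$-valued distribution on $\mathbf T^d$ has a Fourier expansion $v=\sum_kv_ke_k$, $v_k=\overline{v_{-k}}\in\mathbf C^d$. For real $m$, $\mathbb H^m$ is the space of such $v$ with $k\cdot v_k=0$ for all $k$, $v_0=0$ and $\|v\|_m^2:=\sum_{k\in\mathbf Z^d_0}|k|^{2m}|v_k|^2<\infty$. The Leray projection $\mathfrak L$ acts by $(\mathfrak Lv)_k=v_k-\frac{k\cdot v_k}{|k|^2}k$ for $k\ne0$, $(\mathfrak Lv)_0=v_0$. $\mathcal P(v,w)=\mathfrak L(v\cdot\partial w)$, $(v\cdot\partial w)_s=\sum_{r=1}^dv_r\partial_rw_s$; for $p>d/2$ it maps $\mathbb H^p\times\mathbb H^{p+1}$ to $\mathbb H^p$. For $p\ge n>d/2$, $K_{pn}$ is the sharp (i.e. minimum) constant $K$ such that $\|\mathcal P(v,w)\|_p\le\frac12K(\|v\|_p\|w\|_{n+1}+\|v\|_n\|w\|_{p+1})$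 for all $v\in\mathbb H^p$, $w\in\mathbb H^{p+1}$ (such constants exist). *)

(* Defs.v *)
From HB Require Import structures.
From mathcomp Require Import all_boot all_order all_algebra.
From mathcomp Require Import complex.
From mathcomp Require Import all_classical all_reals all_analysis.

Set Implicit Arguments.
Unset Strict Implicit.
Unset Printing Implicit Defensive.

Import Order.TTheory GRing.Theory Num.Theory.
Import numFieldNormedType.Exports.

Local Open Scope classical_set_scope.
Local Open Scope ring_scope.

(* The bilinear product a . b on C^d: no conjugation. *)
Definition cdot (R : realType) (d : nat) (a b : 'rV[R[i]]_d) : R[i] :=
  \sum_(r < d) a 0 r * b 0 r.

Definition cnorm (R : realType) (d : nat) (a : 'rV[R[i]]_d) : R :=
  Num.sqrt (complex.Re (cdot (map_mx (@conjc R) a) a)).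

Definition freq (R : realType) (d : nat) (k : 'rV[int]_d) : 'rV[R[i]]_d :=
  map_mx intr k.

(* e_k, as a 2 pi-periodic function on R^d. *)
Definition echar (R : realType) (d : nat) (k : 'rV[int]_d) (x : 'rV[R]_d) :
    R[i] :=
  let t := \sum_(r < d) (k 0 r)%:~R * x 0 r in
  ((2 * pi) `^ (- (d%:R / 2)))%:C%C * (cos t +i* sin t)%C.

(* A C^d-valued distribution v on the torus is represented by the family
   k |-> v_k of its Fourier coefficients; the reality condition is part of
   [Hsp] below, and the polynomial growth of the coefficients is a consequence
   of the finiteness of a Sobolev norm. *)
Definition distr (R : realType) (d : nat) : Type := 'rV[int]_d -> 'rV[R[i]]_d.

Definition sobolev (R : realType) (d : nat) (m : R) (v : distr R d) : \bar R :=
  sqrte (\esum_(k in [set k : 'rV[int]_d | k != 0])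
           (cnorm (freq R k) `^ (2 * m) * cnorm (v k) ^+ 2)%:E).

Definition Hsp (R : realType) (d : nat) (m : R) : set (distr R d) :=
  [set v | [/\ forall k, v k = map_mx (@conjc R) (v (- k)),
               forall k, cdot (freq R k) (v k) = 0,
               v 0 = 0 &
               (sobolev m v < +oo)%E] ].

Definition leray (R : realType) (d : nat) (v : distr R d) : distr R d :=
  fun k => if k == 0 then v k
           else v k - (cdot (freq R k) (v k)
                         / ((cnorm (freq R k)) ^+ 2)%:C%C) *: freq R k.

(* Unordered sums of absolutely summable real and complex families. *)
Definition rsum (R : realType) (T : choiceType) (f : T -> R) : R :=
  fine (\esum_(k in [set: T]) (Num.max (f k) 0)%:E) -
  fine (\esum_(k in [set: T]) (Num.max (- f k) 0)%:E).

Definition csum (R : realType) (T : choiceType) (f : T -> R[i]) : R[i] :=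
  (rsum (fun k => complex.Re (f k)) +i* rsum (fun k => complex.Im (f k)))%C.

(* The function x |-> \sum_k v_k e_k(x), meaningful when the coefficients of v
   are absolutely summable, in particular for v in H^m with m > d/2. *)
Definition distr_fun (R : realType) (d : nat) (v : distr R d) (x : 'rV[R]_d) :
    'rV[R[i]]_d :=
  \row_s csum (fun k => v k 0 s * echar k x).

(* The distributional derivative with respect to x_r. *)
Definition pderiv (R : realType) (d : nat) (r : 'I_d) (w : distr R d) :
    distr R d :=
  fun k => (0 +i* (k 0 r)%:~R)%C *: w k.

Definition int_circle (R : realType) (f : R -> R[i]) : R[i] :=
  ((\int[@lebesgue_measure R]_(t in `[0, 2 * pi]) complex.Re (f t)) +i*
   (\int[@lebesgue_measure R]_(t in `[0, 2 * pi]) complex.Im (f t)))%C.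

(* Iterated integral over [0, 2 pi]^d. The library has no Lebesgue measure on
   R^d; on the continuous functions to which this is applied, the iterated
   integral is the Lebesgue integral, by Fubini. *)
Fixpoint int_torus (R : realType) (d : nat) : ('rV[R]_d -> R[i]) -> R[i] :=
  match d with
  | 0 => fun f => f 0
  | d'.+1 => fun f =>
      int_circle (fun t : R => int_torus (fun y : 'rV[R]_d' =>
        f (row_mx (t%:M : 'rV[R]_1) y : 'rV[R]_(1 + d'))))
  end.

Definition fourier (R : realType) (d : nat) (f : 'rV[R]_d -> 'rV[R[i]]_d) :
    distr R d :=
  fun k => \row_s int_torus (fun x => f x 0 s * conjc (echar k x)).

(* The function v . \partial w, a pointwise product. *)
Definition advection (R : realType) (d : nat) (v w : distr R d)
    (x : 'rV[R]_d) : 'rV[R[i]]_d :=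
  \row_s \sum_(r < d) distr_fun v x 0 r * distr_fun (pderiv r w) x 0 s.

Definition Pmap (R : realType) (d : nat) (v w : distr R d) : distr R d :=
  leray (fourier (advection v w)).

Definition admissible (R : realType) (d : nat) (p n : R) : set R :=
  [set K | forall v w : distr R d, Hsp p v -> Hsp (p + 1) w ->
     (sobolev p (Pmap v w) <=
      (2^-1 * K)%:E * (sobolev p v * sobolev (n + 1) w +
                       sobolev n v * sobolev (p + 1) w))%E].

(* See [Ksharp_minE]: a real number is the value of [Ksharp] exactly when it is
   the minimum of the admissible constants. *)
Definition Ksharp (R : realType) (d : nat) (p n : R) : \bar R :=
  ereal_inf (EFin @` admissible d p n).

Definition Ucst (R : realType) (d : nat) : R :=
  if (3 <= d)%N then 1 else (Num.sqrt 2)^-1.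

Definition Kminus (R : realType) (d : nat) (p : R) : R :=
  Ucst R d / (2 * pi) `^ (d%:R / 2) * 2 `^ (p / 2).

Lemma sobolev_ge0 (R : realType) (d : nat) (m : R) (v : distr R d) :
  (0 <= sobolev m v)%E.
Proof. exact: sqrte_ge0. Qed.

Lemma cnorm_freq_ge1 (R : realType) (d : nat) (k : 'rV[int]_d) :
  k != 0 -> 1 <= cnorm (freq R k).
Proof.
have reD (x y : R[i]) : complex.Re (x + y) = complex.Re x + complex.Re y.
  by case: x y => [? ?] [? ?].
have kE : complex.Re (cdot (map_mx (@conjc R) (freq R k)) (freq R k)) =
    \sum_(r < d) ((k 0 r) ^+ 2)%:~R.
  rewrite /cdot (big_morph _ reD (erefl : complex.Re 0 = 0)).
  apply: eq_bigr => r _; rewrite !mxE.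
  have -> : ((k 0 r)%:~R : R[i]) = ((k 0 r)%:~R +i* 0)%C by rewrite -(rmorph_int (real_complex R)).
  by rewrite /= oppr0 mul0r subr0 -intrM.
move=> /eqP k0; rewrite /cnorm -[leLHS]sqrtr1 ler_wsqrtr// kE.
have [r kr0] : exists r, k 0 r != 0.
  apply/existsP; rewrite -negb_forall; apply/negP => /forallP k0'; apply: k0.
  by apply/rowP => r; rewrite mxE; exact/eqP.
rewrite (bigD1 r)//= -[leLHS]addr0 lerD//.
  by rewrite -[1]/(1%:~R) ler_int -gtz0_ge1 exprn_even_gt0.
by rewrite sumr_ge0// => j _; rewrite ler0z sqr_ge0.
Qed.

Lemma le_sobolev (R : realType) (d : nat) (m m' : R) (v : distr R d) :
  m <= m' -> (sobolev m v <= sobolev m' v)%E.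
Proof.
move=> mm'; rewrite lee_sqrt; last first.
  by apply: esum_ge0 => k _; rewrite lee_fin mulr_ge0 ?powR_ge0 ?sqr_ge0.
apply: le_esum => k /= k0; rewrite lee_fin ler_wpM2r ?sqr_ge0//.
by rewrite ler_powR ?cnorm_freq_ge1// ler_wpM2l.
Qed.

Lemma Ksharp_minE (R : realType) (d : nat) (p n : R) (np : n <= p) (K : R) :
  Ksharp d p n = K%:E <->
  admissible d p n K /\ (forall K', admissible d p n K' -> K <= K').
Proof.
split=> [KE|[aK minK]]; last first.
  apply/eqP; rewrite eq_le; apply/andP; split.
    by apply: ereal_inf_lbound; exists K.
  by apply: le_ereal_inf_tmp => _ [K' aK' <-]; rewrite lee_fin minK.
have lbK K' : admissible d p n K' -> K <= K'.
  by move=> aK'; rewrite -lee_fin -KE; apply: ereal_inf_lbound; exists K'.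
split=> // v w Hv Hw.
have fin m (u : distr R d) : (sobolev m u < +oo)%E -> sobolev m u \is a fin_num.
  by move=> ?; rewrite ge0_fin_numE ?sobolev_ge0.
have [_ _ _ vp] := Hv; have [_ _ _ wp] := Hw.
have vn := le_lt_trans (le_sobolev v np) vp.
have wn : (sobolev (n + 1) w < +oo)%E.
  by apply: le_lt_trans wp; rewrite le_sobolev// lerD2r.
set A := (_ + _)%E.
have [a a0 AE] : exists2 a : R, 0 <= a & A = a%:E.
  exists (fine A); first by rewrite fine_ge0// adde_ge0// mule_ge0// sobolev_ge0.
  by rewrite fineK// fin_numD !fin_numM ?fin.
rewrite AE -EFinM; apply/lee_addgt0Pr => e e0.
have ea0 : 0 < e / (a + 1) by rewrite divr_gt0// ltr_wpDl.
have [_ [K' aK' <-] K'lt] : exists2 x, (EFin @` admissible d p n) x &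
    (x < (K + e / (a + 1))%:E)%E.
  apply: ereal_inf_lt; rewrite -[ereal_inf _]/(Ksharp d p n) KE lte_fin.
  by rewrite ltrDl.
apply: (le_trans (aK' v w Hv Hw)).
rewrite -/A AE -EFinM -EFinD lee_fin.
rewrite lte_fin in K'lt.
apply: (@le_trans _ _ (2^-1 * (K + e / (a + 1)) * a)).
  by rewrite ler_wpM2r// ler_wpM2l// ltW.
rewrite mulrDr mulrDl lerD2l.
rewrite -mulrA; apply: (@le_trans _ _ (e / (a + 1) * a)).
  by rewrite ler_piMl ?(mulr_ge0 (ltW ea0))// invf_le1 ?ltr0n// ler1n.
by rewrite mulrAC ler_pdivrMr ?ltr_wpDl// ler_pM2l// lerDl.
Qed.

(* Main.v *)
Require Import Defs.
From mathcomp Require Import all_boot all_order all_algebra.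
From mathcomp Require Import complex ring lra.
From mathcomp Require Import all_classical all_reals all_analysis.
Import Order.TTheory GRing.Theory Num.Theory.
Import numFieldNormedType.Exports.
Local Open Scope classical_set_scope.
Local Open Scope ring_scope.

(** The bound comes from testing the inequality on one pair of fields.  Number
    the coordinates from 0 and take two shear flows
      v = 2 N cos(x_0) e_1,   w = 2 N cos(x_1) e_s,   N = (2 pi)^(-d/2),
    with s = 0 if d = 2 and s = 2 if d >= 3.  They are divergence free because
    each one points across the direction in which it varies.  Each has just
    two Fourier modes, both of frequency length 1, so all its Sobolev norms
    have the same value sqrt 2 ([sobolev_shear]) and the right-hand side of
    the inequality for K is 2 K for all p and n.

    As v . d w = - 4 N^2 cos(x_0) sin(x_1) e_s ([advection_shear]), the field
    P(v, w) lives on the four frequencies (+-1, +-1, 0, ..., 0), the corners,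
    of length sqrt 2.  There the Fourier coefficient of v . d w is +-i N e_s
    ([fourier_advection_corner]).  The Leray projection leaves it unchanged
    when e_s is orthogonal to the corners (d >= 3), and for s = 0 divides its
    length by sqrt 2 (d = 2); the factor is U_d in both cases ([Pmap_corner]).
    So the four modes together give P(v, w) an H^p norm of at least
    2 * 2^(p/2) N U_d ([le_sobolev_Pmap]).  Since this is at most 2 K, one gets
    K >= 2^(p/2) N U_d. *)

(** * Finitely supported sums *)

Lemma esum_seq (R : realType) (T : choiceType) (D : set T) (s : seq T)
    (a : T -> \bar R) :
  uniq s -> [set` s] `<=` D -> (forall k, 0 <= a k)%E ->
  (forall k, D k -> k \notin s -> a k = 0%E) ->
  (\esum_(k in D) a k = \sum_(k <- s) a k)%E.
Proof.
move=> us sD a0 aD; rewrite fsbig_seq// -esum_fset//.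
rewrite (esumID [set` s])// (setIidr sD).
by rewrite [X in (_ + X)%E]esum1 ?adde0// => k [Dk /negP]; exact: aD.
Qed.

Lemma le_sum_esum (R : realType) (T : choiceType) (D : set T) (s : seq T)
    (a : T -> \bar R) :
  uniq s -> [set` s] `<=` D -> (\sum_(k <- s) a k <= \esum_(k in D) a k)%E.
Proof.
move=> us sD; rewrite fsbig_seq//; by apply: esum_ge; exists [set` s].
Qed.

Lemma rsum_seq (R : realType) (T : choiceType) (s : seq T) (f : T -> R) :
  uniq s -> (forall k, k \notin s -> f k = 0) ->
  rsum f = \sum_(k <- s) f k.
Proof.
move=> us f0; rewrite /rsum !(esum_seq _ _ _ s)//.
- rewrite !sumEFin /= -sumrB; apply: eq_bigr => k _.
  by rewrite /Num.max; case: ifP; case: ifP; lra.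
- by move=> k; rewrite lee_fin le_max lexx orbT.
- by move=> k _ ks; rewrite f0// oppr0 maxxx.
- by move=> k; rewrite lee_fin le_max lexx orbT.
- by move=> k _ ks; rewrite f0// maxxx.
Qed.

Lemma csum_seq (R : realType) (T : choiceType) (s : seq T) (f : T -> R[i]) :
  uniq s -> (forall k, k \notin s -> f k = 0) ->
  csum f = \sum_(k <- s) f k.
Proof.
move=> us f0; rewrite /csum !(rsum_seq _ _ s)//; try by move=> k /f0 ->.
elim: (s) => [|k r IH]; first by rewrite !big_nil.
by rewrite !big_cons -IH; case: (f k).
Qed.

(** * Integrals over the circle and the torus *)

Lemma Rintegral_FTC (R : realType) (F f : R -> R) :
  continuous f -> (forall x, is_derive (x : R) (1 : R) F (f x)) ->
  \int[@lebesgue_measure R]_(t in `[0, 2 * pi]) f t = F (2 * pi) - F 0.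
Proof.
move=> cf dF; have pi0 : 0 < 2 * pi :> R by rewrite mulr_gt0 ?pi_gt0.
have cF : continuous F.
  by move=> x; apply/differentiable_continuous/derivable1_diffP; case: (dF x).
rewrite /Rintegral (@continuous_FTC2 _ f F)//.
- exact: continuous_subspaceT.
- split; first by move=> x _; case: (dF x).
  + exact/cvg_at_right_filter/cF.
  + exact/cvg_at_left_filter/cF.
- by move=> x _; rewrite derive1E; have [_ ->] := dF x.
Qed.

Lemma sin_2pi (R : realType) : sin (2 * pi) = 0 :> R.
Proof. by rewrite mulr_natl sin2pi. Qed.

Lemma int_cos2 (R : realType) :
  \int[@lebesgue_measure R]_(t in `[0, 2 * pi]) (cos t * cos t) = pi.
Proof.
pose F t : R := 2^-1 * (t + sin t * cos t).
have dF x : is_derive x (1 : R) F (cos x * cos x).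
  apply: is_derive_eq; rewrite /GRing.scale /=.
  by have := cos2Dsin2 x; rewrite !expr2; nra.
rewrite (Rintegral_FTC _ F _ _ dF) /F.
  by rewrite sin0 sin_2pi; lra.
by move=> x; apply: continuousM; exact: continuous_cos.
Qed.

Lemma int_sin2 (R : realType) :
  \int[@lebesgue_measure R]_(t in `[0, 2 * pi]) (sin t * sin t) = pi.
Proof.
pose F t : R := 2^-1 * (t - sin t * cos t).
have dF x : is_derive x (1 : R) F (sin x * sin x).
  apply: is_derive_eq; rewrite /GRing.scale /=.
  by have := cos2Dsin2 x; rewrite !expr2; nra.
rewrite (Rintegral_FTC _ F _ _ dF) /F.
  by rewrite sin0 sin_2pi; lra.
by move=> x; apply: continuousM; exact: continuous_sin.
Qed.

Lemma int_sincos (R : realType) :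
  \int[@lebesgue_measure R]_(t in `[0, 2 * pi]) (sin t * cos t) = 0.
Proof.
pose F t : R := 2^-1 * (sin t * sin t).
have dF x : is_derive x (1 : R) F (sin x * cos x).
  by apply: is_derive_eq; rewrite /GRing.scale /=; lra.
rewrite (Rintegral_FTC _ F _ _ dF) /F.
  by rewrite sin0 sin_2pi; lra.
by move=> x; apply: continuousM; [exact: continuous_sin|exact: continuous_cos].
Qed.

Definition cis {R : realType} (t : R) : R[i] := (cos t +i* sin t)%C.

Lemma cisD (R : realType) (s t : R) : cis (s + t) = cis s * cis t.
Proof. by rewrite /cis cosD sinD; simpc; rewrite [cos s * sin t + _]addrC. Qed.

Lemma integrable_circle (R : realType) (f : R -> R) :
  continuous f ->
  (@lebesgue_measure R).-integrable `[0, 2 * pi] (EFin \o f).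
Proof.
move=> cf; apply: continuous_compact_integrable; first exact: segment_compact.
exact: continuous_subspaceT.
Qed.

(** The continuity assumptions give the integrability that the real linearity
    of the integral asks for, after splitting into real and imaginary parts. *)
Lemma int_circleZ (R : realType) (z : R[i]) (f : R -> R[i]) :
  continuous (@complex.Re R \o f) -> continuous (@complex.Im R \o f) ->
  int_circle (fun t => z * f t) = z * int_circle f.
Proof.
case: z => a b cRe cIm.
have ReE t : complex.Re ((a +i* b)%C * f t) =
    a * complex.Re (f t) - b * complex.Im (f t) by case: (f t).
have ImE t : complex.Im ((a +i* b)%C * f t) =
    a * complex.Im (f t) + b * complex.Re (f t) by case: (f t).
have cZ (c : R) (g : R -> R) : continuous g -> continuous (fun t => c * g t).
  by move=> cg t; apply: continuousM; [exact: cvg_cst|exact: cg].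
rewrite /int_circle.
under eq_Rintegral do rewrite ReE.
under [X in (_ +i* X)%C]eq_Rintegral do rewrite ImE.
have iZ c g : continuous g -> _ := fun cg => integrable_circle _ _ (cZ c g cg).
rewrite RintegralB ?RintegralD ?RintegralZl//;
  by [exact: integrable_circle|exact: iZ].
Qed.

Lemma int_circle_cst (R : realType) (z : R[i]) :
  int_circle (fun=> z) = (2 * pi)%:C%C * z.
Proof.
case: z => a b; rewrite /int_circle !Rintegral_cst//= lebesgue_measure_itv /=.
rewrite lte_fin mulr_gt0 ?pi_gt0//= subr0; simpc.
by rewrite ![_ * (2 * pi)]mulrC.
Qed.

Lemma int_torus_cst (R : realType) (d : nat) (z : R[i]) :
  int_torus (fun _ : 'rV[R]_d => z) = ((2 * pi) ^+ d)%:C%C * z.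
Proof.
elim: d => [|d IH] /=; first by rewrite mul1r.
by rewrite IH int_circle_cst exprS [in RHS]rmorphM mulrA.
Qed.

Lemma continuous_sincos (R : realType) :
  continuous (fun t : R => sin t * cos t).
Proof.
by move=> x; apply: continuousM; [exact: continuous_sin|exact: continuous_cos].
Qed.

(** The next two lemmas are the unnormalized Fourier coefficients of cos and sin
    at the frequencies 1 and -1, the sign being (-1)^b. *)
Lemma int_circle_cos (R : realType) (b : bool) :
  int_circle (fun t : R => (cos t)%:C * (cis ((-1) ^+ b * t))^*)%C = (pi%:C)%C.
Proof.
rewrite /int_circle /cis; congr (_ +i* _)%C.
  rewrite -[RHS]int_cos2; apply: eq_Rintegral => t _.
  by case: b; rewrite ?mulN1r ?mul1r ?cosN /= mul0r subr0.
rewrite -[RHS](mulr0 (- (-1) ^+ b)) -[X in _ = _ * X]int_sincos.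
rewrite -RintegralZl//; last exact/integrable_circle/continuous_sincos.
apply: eq_Rintegral => t _; case: b; rewrite ?mulN1r ?mul1r ?sinN /=; ring.
Qed.

Lemma int_circle_sin (R : realType) (b : bool) :
  int_circle (fun t : R => (sin t)%:C * (cis ((-1) ^+ b * t))^*)%C =
  (0 -i* ((-1) ^+ b * pi))%C.
Proof.
rewrite /int_circle /cis; congr (_ +i* _)%C.
  rewrite -[RHS]int_sincos; apply: eq_Rintegral => t _.
  by case: b; rewrite ?mulN1r ?mul1r ?cosN /= mul0r subr0.
rewrite -mulNr -[X in _ = _ * X]int_sin2 -RintegralZl//; last first.
  apply: integrable_circle.
  by move=> x; apply: continuousM; exact: continuous_sin.
apply: eq_Rintegral => t _; case: b; rewrite ?mulN1r ?mul1r ?sinN /=; ring.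
Qed.

(** Fubini for a product of functions of the first two coordinates: peeling off
    two circles leaves a constant, whose integral over the remaining circles
    is a power of 2 pi. *)
Lemma int_torus_prod (R : realType) (d : nat) (z : R[i]) (F G : R -> R[i]) :
  continuous (@complex.Re R \o F) -> continuous (@complex.Im R \o F) ->
  continuous (@complex.Re R \o G) -> continuous (@complex.Im R \o G) ->
  int_torus (fun x : 'rV[R]_d.+2 =>
    z * (F (x 0 ord0) * G (x 0 (lift ord0 ord0)))) =
  z * (((2 * pi) ^+ d)%:C%C * (int_circle F * int_circle G)).
Proof.
move=> cReF cImF cReG cImG; set N := (_%:C)%C.
transitivity (int_circle (fun t : R =>
    (z * N * int_circle G) * F t)); last first.
  by rewrite int_circleZ//; ring.
rewrite /=; congr int_circle; apply/funext => t.
transitivity (int_circle (fun u : R => (z * N * F t) * G u)); last first.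
  by rewrite int_circleZ//; ring.
congr int_circle; apply/funext => u.
transitivity (int_torus (fun _ : 'rV[R]_d => z * (F t * G u))).
  congr int_torus; apply/funext => y.
  have row0 m (a : R) (y' : 'rV[R]_m) :
      (row_mx (a%:M : 'rV[R]_1) y' : 'rV[R]_(1 + m)) 0 ord0 = a.
    by rewrite mxE; case: splitP => // i _; rewrite mxE !ord1 eqxx.
  have row1 m (a : R) (y' : 'rV[R]_m.+1) :
      (row_mx (a%:M : 'rV[R]_1) y' : 'rV[R]_(1 + m.+1)) 0 (lift ord0 ord0) =
      y' 0 ord0.
    rewrite mxE; case: splitP => [i|i [i0]]; first by rewrite ord1.
    by congr (y' _ _); exact/val_inj.
  by rewrite row0 row1 row0.
by rewrite int_torus_cst -/N; ring.
Qed.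

(** * Lengths of complex vectors and frequencies *)

(** The normalization constant (2 pi)^(-d/2) of the characters e_k. *)
Definition fnorm {R : realType} (d : nat) : R := (2 * pi) `^ (- (d%:R / 2)).

Lemma fnorm_sqr (R : realType) (d : nat) :
  fnorm d ^+ 2 * (2 * pi) ^+ d = 1 :> R.
Proof.
have pi0 : 0 < 2 * pi :> R by rewrite mulr_gt0 ?pi_gt0.
rewrite /fnorm -powR_mulrn ?powR_ge0// -powRrM -powR_mulrn ?ltW//.
by rewrite -powRD ?(gt_eqF pi0) ?implybT// mulNr mulfVK// addNr powRr0.
Qed.

Lemma echarE (R : realType) (d : nat) (k : 'rV[int]_d) (x : 'rV[R]_d) :
  echar k x = (fnorm d)%:C%C * cis (\sum_(r < d) (k 0 r)%:~R * x 0 r).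
Proof. by []. Qed.

Lemma cnorm_sqr (R : realType) (d : nat) (a : 'rV[R[i]]_d) :
  cnorm a ^+ 2 =
  \sum_(r < d) (complex.Re (a 0 r) ^+ 2 + complex.Im (a 0 r) ^+ 2).
Proof.
have reD : {morph @complex.Re R : x y / x + y} by case=> [? ?] [? ?].
have E : complex.Re (cdot (map_mx (@conjc R) a) a) =
    \sum_(r < d) (complex.Re (a 0 r) ^+ 2 + complex.Im (a 0 r) ^+ 2).
  rewrite /cdot (big_morph _ reD (erefl : complex.Re 0 = 0)).
  apply: eq_bigr => r _; rewrite mxE; case: (a 0 r) => u v /=; ring.
by rewrite /cnorm E sqr_sqrtr// sumr_ge0// => r _; rewrite addr_ge0// sqr_ge0.
Qed.

Lemma cnorm_sqr_scale (R : realType) (d : nat) (z : R[i]) (u : 'rV[R]_d) :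
  cnorm (z *: map_mx (real_complex R) u) ^+ 2 =
  (complex.Re z ^+ 2 + complex.Im z ^+ 2) * \sum_(r < d) u 0 r ^+ 2.
Proof.
rewrite cnorm_sqr mulr_sumr; apply: eq_bigr => r _; rewrite !mxE.
by case: z => a b /=; ring.
Qed.

Lemma freqE (R : realType) (d : nat) (k : 'rV[int]_d) :
  freq R k = map_mx (real_complex R) (map_mx intr k).
Proof. by apply/rowP => r; rewrite !mxE rmorph_int. Qed.

Lemma cnorm_freq_sqr (R : realType) (d : nat) (k : 'rV[int]_d) :
  cnorm (freq R k) ^+ 2 = \sum_(r < d) (k 0 r)%:~R ^+ 2.
Proof.
rewrite freqE -[map_mx _ _]scale1r cnorm_sqr_scale /= expr1n expr0n addr0 mul1r.
by apply: eq_bigr => r _; rewrite mxE.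
Qed.

Lemma cnorm_ge0 (R : realType) (d : nat) (a : 'rV[R[i]]_d) : 0 <= cnorm a.
Proof. exact: sqrtr_ge0. Qed.

(** * Shear flows *)

Definition unitf (d : nat) (j : 'I_d) : 'rV[int]_d := delta_mx 0 j.

(** Fourier coefficients of 2 (2 pi)^(-d/2) cos(x_j) e_r; see
    [distr_fun_shear]. *)
Definition shear {R : realType} {d : nat} (j r : 'I_d) : distr R d :=
  fun k => if k \in [:: unitf _ j; - unitf _ j] then delta_mx 0 r else 0.

Lemma unitf_uniq (d : nat) (j : 'I_d) : uniq [:: unitf _ j; - unitf _ j].
Proof.
rewrite /= inE andbT; apply/eqP => /rowP/(_ j).
by rewrite /unitf !mxE !eqxx.
Qed.

Lemma unitf_neq0 (d : nat) (j : 'I_d) : unitf _ j != 0.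
Proof. by apply/eqP => /rowP/(_ j); rewrite !mxE !eqxx. Qed.

Lemma sum_delta (A : pzRingType) (d : nat) (j : 'I_d) (f : 'I_d -> A) :
  \sum_(r < d) (r == j)%:R * f r = f j.
Proof.
rewrite (bigD1 j)//= eqxx mul1r big1 ?addr0// => r /negbTE ->.
by rewrite mul0r.
Qed.

Lemma cnorm_unitf (R : realType) (d : nat) (j : 'I_d) :
  cnorm (freq R (unitf _ j)) = 1.
Proof.
apply/eqP; rewrite -(@eqrXn2 _ 2) ?cnorm_ge0 ?ler01// expr1n cnorm_freq_sqr.
rewrite -[X in _ == X](sum_delta _ _ j (fun=> 1)); apply/eqP/eq_bigr => r _.
by rewrite mxE eqxx/=; case: (r == j); rewrite ?expr0n ?mul0r// expr1n mul1r.
Qed.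

Lemma cnorm_freqN (R : realType) (d : nat) (k : 'rV[int]_d) :
  cnorm (freq R (- k)) = cnorm (freq R k).
Proof.
apply/eqP; rewrite -(@eqrXn2 _ 2) ?cnorm_ge0 // !cnorm_freq_sqr.
by apply/eqP/eq_bigr => r _; rewrite mxE mulrNz sqrrN.
Qed.

Lemma cnorm_delta (R : realType) (d : nat) (j : 'I_d) :
  cnorm (delta_mx 0 j : 'rV[R[i]]_d) = 1.
Proof.
rewrite -(cnorm_unitf R _ j) /freq /unitf; congr cnorm.
by rewrite map_delta_mx.
Qed.

(** Independent of [m], because the two frequencies have length 1. *)
Lemma sobolev_shear (R : realType) (d : nat) (m : R) (j r : 'I_d) :
  sobolev m (shear j r : distr R d) = (Num.sqrt 2)%:E.
Proof.
rewrite /sobolev (esum_seq _ _ _ _ _ (unitf_uniq _ j)).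
- rewrite !big_cons big_nil adde0 /shear !inE !eqxx orbT /= cnorm_freqN.
  by rewrite cnorm_unitf cnorm_delta powR1 expr1n mulr1.
- by move=> k /=; rewrite !inE => /orP[]/eqP ->; rewrite ?oppr_eq0 unitf_neq0.
- by move=> k; rewrite lee_fin mulr_ge0 ?powR_ge0 ?sqr_ge0.
- move=> k _ /negbTE kj; rewrite /shear kj cnorm_sqr big1 ?mulr0// => i _.
  by rewrite mxE /= expr0n addr0.
Qed.

(** A flow directed along x_r that varies only with x_j, r != j, is
    divergence free. *)
Lemma Hsp_shear (R : realType) (d : nat) (m : R) (j r : 'I_d) :
  r != j -> Hsp m (shear j r : distr R d).
Proof.
move=> rj; split; last by rewrite sobolev_shear ltry.
- move=> k; rewrite /shear !inE eqr_oppLR eqr_opp orbC.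
  by case: ifP => _; rewrite ?map_delta_mx ?raddf0.
- move=> k; rewrite /shear !inE; case: ifPn => [kj|_]; last first.
    by rewrite /cdot big1// => i _; rewrite !mxE mulr0.
  rewrite /cdot (bigD1 r)//= big1 ?addr0 => [|i /negbTE ir]; last first.
    by rewrite !mxE eqxx ir mulr0.
  by case/orP: kj => /eqP ->; rewrite !mxE (negbTE rj) ?oppr0 mul0r.
- by rewrite /shear !inE ![0 == _]eq_sym oppr_eq0 (negbTE (unitf_neq0 _ _)).
Qed.

Lemma echar_unitf (R : realType) (d : nat) (j : 'I_d) (x : 'rV[R]_d) :
  echar (unitf _ j) x = (fnorm d)%:C%C * cis (x 0 j).
Proof.
rewrite echarE -[in RHS](sum_delta _ _ j (fun r => x 0 r)).
by congr (_ * cis _); apply: eq_bigr => r _; rewrite mxE eqxx; case: eqP.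
Qed.

Lemma echar_unitfN (R : realType) (d : nat) (j : 'I_d) (x : 'rV[R]_d) :
  echar (- unitf _ j) x = (fnorm d)%:C%C * cis (- x 0 j).
Proof.
rewrite echarE -[in RHS](sum_delta _ _ j (fun r => x 0 r)) -sumrN.
congr (_ * cis _); apply: eq_bigr => r _; rewrite !mxE eqxx.
by case: eqP => _; rewrite ?mul1r ?mul0r ?oppr0 ?mul0r ?mulN1r.
Qed.

Lemma distr_fun_shear (R : realType) (d : nat) (j r : 'I_d) (x : 'rV[R]_d) :
  distr_fun (shear j r) x = (2 * fnorm d * cos (x 0 j))%:C%C *: delta_mx 0 r.
Proof.
apply/rowP => s; rewrite mxE (csum_seq _ _ _ _ (unitf_uniq _ j)); last first.
  by move=> k /negbTE kj; rewrite /shear kj mxE mul0r.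
rewrite !big_cons big_nil addr0 /shear !inE !eqxx orbT /= !mxE.
rewrite echar_unitf echar_unitfN -mulrDr [LHS]mulrC; congr (_ * _).
by rewrite /cis cosN sinN; simpc; congr Complex; ring.
Qed.

Lemma distr_fun_pderiv_shear (R : realType) (d : nat) (l j r : 'I_d)
    (x : 'rV[R]_d) :
  distr_fun (pderiv l (shear j r)) x =
  ((l == j)%:R * (- 2 * fnorm d * sin (x 0 j)))%:C%C *: delta_mx 0 r.
Proof.
apply/rowP => s; rewrite mxE (csum_seq _ _ _ _ (unitf_uniq _ j)); last first.
  by move=> k /negbTE kj; rewrite /pderiv /shear kj !mxE mulr0 mul0r.
rewrite !big_cons big_nil addr0 /pderiv /shear !inE !eqxx orbT /= !mxE.
rewrite echar_unitf echar_unitfN !eqxx /=.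
case: (l == j) => /=; last by rewrite oppr0; simpc.
case: (s == r); last by rewrite !mulr0 !mul0r addr0.
by rewrite /cis cosN sinN !mulr1; simpc; congr Complex; ring.
Qed.

(** The field [shear i j] points along x_j, so only the derivative in x_j, the
    variable of the second flow, contributes. *)
Lemma advection_shear (R : realType) (d : nat) (i j r : 'I_d) (x : 'rV[R]_d) :
  advection (shear i j) (shear j r) x =
  (- 4 * fnorm d ^+ 2 * (cos (x 0 i) * sin (x 0 j)))%:C%C *: delta_mx 0 r.
Proof.
apply/rowP => s; rewrite mxE (bigD1 j)//= big1 ?addr0 => [|l /negbTE lj];
  last first.
  by rewrite distr_fun_shear mxE [delta_mx _ _ _ _]mxE lj mulr0 mul0r.
rewrite distr_fun_shear distr_fun_pderiv_shear !mxE !eqxx mulr1 mulrA mul1r.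
by congr (_ * _); rewrite -rmorphM; congr (_%:C)%C; ring.
Qed.

(** * The product of two shear flows at the corner frequencies *)

(** The frequencies (+-1, +-1, 0, ..., 0). *)
Definition corner (d : nat) (b : bool * bool) : 'rV[int]_d.+2 :=
  \row_r (if r == ord0 then (-1) ^+ b.1
          else if r == lift ord0 ord0 then (-1) ^+ b.2 else 0).

Lemma corner_inj (d : nat) : injective (@corner d).
Proof.
move=> [b c] [b' c'] /rowP bc; move: (bc ord0) (bc (lift ord0 ord0)).
by rewrite !mxE /=; case: b b' c c' {bc} => [] [] [] [].
Qed.

Lemma corner_neq0 (d : nat) (b : bool * bool) : corner d b != 0.
Proof. by apply/eqP => /rowP/(_ ord0); rewrite !mxE /=; case: b.1. Qed.

(** A sum over the coordinates of a corner has only two terms.  Taking [g]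
    abstract covers both the length of a corner and its phase k . x. *)
Lemma sum_corner (R : realType) (d : nat) (b : bool * bool)
    (g : int -> 'I_d.+2 -> R) :
  (forall r, g 0 r = 0) ->
  \sum_(r < d.+2) g (corner d b 0 r) r =
  g ((-1) ^+ b.1) ord0 + g ((-1) ^+ b.2) (lift ord0 ord0).
Proof.
move=> g0; rewrite !big_ord_recl big1 => [|i _]; first by rewrite !mxE /= addr0.
by rewrite mxE /= g0.
Qed.

Lemma corner_sqr (R : realType) (d : nat) (b : bool * bool) :
  \sum_(r < d.+2) (corner d b 0 r)%:~R ^+ 2 = 2 :> R.
Proof.
rewrite (sum_corner _ _ _ (fun k _ => k%:~R ^+ 2)) => [|r];
  last by rewrite expr0n.
by case: b => [[] []] /=; rewrite ?expr1n ?intr_sign ?sqrrN ?expr1n -?natrD.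
Qed.

Lemma echar_corner (R : realType) (d : nat) (b : bool * bool)
    (x : 'rV[R]_d.+2) :
  echar (corner d b) x = (fnorm d.+2)%:C%C *
    (cis ((-1) ^+ b.1 * x 0 ord0) * cis ((-1) ^+ b.2 * x 0 (lift ord0 ord0))).
Proof.
rewrite echarE -cisD (sum_corner _ _ _ (fun k r => k%:~R * x 0 r)).
  by rewrite !intr_sign.
by move=> r; rewrite mul0r.
Qed.

(** The continuity hypotheses of [int_torus_prod] for the integrands below. *)
Lemma continuous_modulated (R : realType) (f : R -> R) (a : R) :
  continuous f ->
  continuous (@complex.Re R \o (fun t => (f t)%:C * (cis (a * t))^*)%C) /\
  continuous (@complex.Im R \o (fun t => (f t)%:C * (cis (a * t))^*)%C).
Proof.
move=> cf.
have cM (g : R -> R) : continuous g -> continuous (fun t => f t * g (a * t)).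
  move=> cg t; apply: continuousM; first exact: cf.
  apply: (@continuous_comp _ _ _ (fun u => a * u) g); last exact: cg.
  by apply: continuousM; [exact: cvg_cst|exact: cvg_id].
have cNsin : continuous (fun u : R => - sin u).
  by move=> t; apply: continuousN; exact: continuous_sin.
split.
  rewrite (_ : _ \o _ = fun t => f t * cos (a * t)).
    exact: (cM _ (@continuous_cos R)).
  by apply/funext => t /=; rewrite mul0r subr0.
rewrite (_ : _ \o _ = fun t => f t * - sin (a * t)); first exact: (cM _ cNsin).
by apply/funext => t /=; rewrite mul0r addr0.
Qed.

(** The integrand is separated: a cosine mode in x_0 and a sine mode in x_1,
    each tested against a character of the same frequency up to sign.  The powers of
    2 pi cancel against N^2, leaving a single factor N. *)
Lemma fourier_advection_corner (R : realType) (d : nat) (s : 'I_d.+2)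
    (b : bool * bool) :
  fourier (advection (shear ord0 (lift ord0 ord0)) (shear (lift ord0 ord0) s))
    (corner d b) =
  (0 +i* ((-1) ^+ b.2 * fnorm d.+2))%C *: (delta_mx 0 s : 'rV[R[i]]_d.+2).
Proof.
set N := fnorm d.+2.
apply/rowP => q; rewrite !mxE.
pose F (t : R) := ((cos t)%:C * (cis ((-1) ^+ b.1 * t))^*)%C.
pose G (t : R) := ((sin t)%:C * (cis ((-1) ^+ b.2 * t))^*)%C.
transitivity (int_torus (fun x : 'rV[R]_d.+2 =>
    ((- 4 * N ^+ 3)%:C%C * (q == s)%:R) *
      (F (x 0 ord0) * G (x 0 (lift ord0 ord0))))).
  congr int_torus; apply/funext => x.
  have conjM (a : R) (y z : R[i]) : ((a%:C * (y * z))^* = a%:C * (y^* * z^*))%C.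
    by rewrite 2!rmorphM; congr (_ * _); exact: conjc_real.
  rewrite echar_corner conjM advection_shear !mxE [0 == 0]eqxx -/N /F /G.
  by rewrite !rmorphM andTb; ring.
have [cReF cImF] := continuous_modulated _ _ ((-1) ^+ b.1) (@continuous_cos R).
have [cReG cImG] := continuous_modulated _ _ ((-1) ^+ b.2) (@continuous_sin R).
rewrite int_torus_prod// int_circle_cos int_circle_sin eqxx /=.
case: (q == s); last by rewrite !mulr0 mul0r.
have := fnorm_sqr R d.+2; rewrite -/N => N2.
rewrite !mulr1; simpc; congr Complex.
(* The factor N^2 (2 pi)^(d + 2) = 1 gives both sides the same powers of N
   and pi. *)
rewrite -[RHS]mulr1 -[X in _ = _ * X]N2.
case: b.2; rewrite !exprS expr0; ring.
Qed.

Lemma cdot_freq_delta (R : realType) (d : nat) (k : 'rV[int]_d) (c : R[i])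
    (s : 'I_d) :
  cdot (freq R k) (c *: delta_mx 0 s) = c * (k 0 s)%:~R%:C%C.
Proof.
rewrite -[RHS](sum_delta _ _ s (fun r => c * (k 0 r)%:~R%:C%C)).
by apply: eq_bigr => r _; rewrite !mxE eqxx rmorph_int /=; ring.
Qed.

(** The Leray projection subtracts from e_s its component (h_s / 2) h along the
    corner h, which has squared length 2; what remains has squared length
    1 - h_s^2 / 2, and h_s^2 is 1 for s = 0 and 0 for s >= 2. *)
Lemma Pmap_corner (R : realType) (d : nat) (s : 'I_d.+2) (b : bool * bool) :
  s != lift ord0 ord0 ->
  cnorm (Pmap (shear ord0 (lift ord0 ord0)) (shear (lift ord0 ord0) s)
     (corner d b)) ^+ 2 = fnorm d.+2 ^+ 2 * (1 - (s == ord0)%:R / 2) :> R.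
Proof.
move=> s1; set h := corner d b; set N := fnorm d.+2.
pose hs : R := (h 0 s)%:~R.
pose u : 'rV[R]_d.+2 := \row_r ((r == s)%:R - hs / 2 * (h 0 r)%:~R).
have -> : Pmap (shear ord0 (lift ord0 ord0)) (shear (lift ord0 ord0) s) h =
    (0 +i* ((-1) ^+ b.2 * N))%C *: map_mx (real_complex R) u.
  rewrite /Pmap /leray (negbTE (corner_neq0 _ _)) fourier_advection_corner -/N.
  set c := (_ +i* _)%C.
  have -> : cdot (freq R h) (c *: delta_mx 0 s) = c * hs%:C%C.
    exact: cdot_freq_delta.
  rewrite cnorm_freq_sqr corner_sqr freqE; apply/rowP => r; rewrite !mxE.
  rewrite rmorphB rmorphM fmorph_div /=; case: (r == s); ring.
rewrite cnorm_sqr_scale /= expr0n add0r exprMn sqrr_sign mul1r; congr (_ * _).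
transitivity (\sum_(r < d.+2) ((r == s)%:R * (1 - hs * (h 0 r)%:~R)
    + (hs / 2) ^+ 2 * (h 0 r)%:~R ^+ 2)).
  apply: eq_bigr => r _; rewrite mxE.
  by case: (r == s) => /=; field.
rewrite big_split /= sum_delta -mulr_sumr corner_sqr /hs !mxE.
rewrite (negbTE s1); case: ifP => [_|_].
  by rewrite intr_sign exprMn -expr2 sqrr_sign /=; lra.
by rewrite mul0r /=; lra.
Qed.

Lemma sqrte_EFin_sqr (R : realType) (x : R) :
  0 <= x -> sqrte (x ^+ 2)%:E = x%:E.
Proof. by move=> x0 /=; rewrite sqrtr_sqr ger0_norm. Qed.

(** Only the four corner modes are kept in the Sobolev sum.  They contribute
    equally, and sqrt 4 = 2 is the leading factor. *)
Lemma le_sobolev_Pmap (R : realType) (d : nat) (p : R) (s : 'I_d.+2) :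
  s != lift ord0 ord0 ->
  ((2 * (2 `^ (p / 2) * (fnorm d.+2 * Num.sqrt (1 - (s == ord0)%:R / 2))))%:E <=
   sobolev p (Pmap (shear ord0 (lift ord0 ord0)) (shear (lift ord0 ord0) s)))%E.
Proof.
move=> s1; set N := fnorm d.+2; set U := Num.sqrt _.
have U0 : 0 <= U by exact: sqrtr_ge0.
have N0 : 0 <= N by exact: powR_ge0.
rewrite -sqrte_EFin_sqr; last by rewrite !mulr_ge0 ?powR_ge0.
rewrite /sobolev lee_sqrt; last first.
  by apply: esum_ge0 => k _; rewrite lee_fin mulr_ge0 ?powR_ge0 ?sqr_ge0.
pose bs := [:: (false, false); (false, true); (true, false); (true, true)].
have us : uniq [seq corner d b | b <- bs].
  by rewrite map_inj_uniq //; exact: corner_inj.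
apply: le_trans (le_sum_esum _ _ _ _ _ us _); last first.
  by move=> k; rewrite /= !inE => /or4P[] /eqP ->; exact: corner_neq0.
rewrite big_map.
have E b : (cnorm (freq R (corner d b)) `^ (2 * p) *
    cnorm (Pmap (shear ord0 (lift ord0 ord0)) (shear (lift ord0 ord0) s)
       (corner d b)) ^+ 2) = (2 `^ (p / 2) * (N * U)) ^+ 2.
  rewrite powRrM powR_mulrn ?cnorm_ge0// cnorm_freq_sqr corner_sqr.
  rewrite Pmap_corner// !exprMn -/N sqr_sqrtr; last first.
    by case: (s == ord0) => /=; lra.
  congr (_ * _); rewrite -powR_mulrn ?powR_ge0// -powRrM; congr (_ `^ _); lra.
under eq_bigr do rewrite E.
rewrite /bs !big_cons big_nil adde0 -!EFinD lee_fin; lra.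
Qed.

(** * The lower bound *)

Theorem proposition9p1 (R : realType) (d : nat) (hd : (2 <= d)%N) (p n : R)
    (hn : d%:R / 2 < n) (hp : n <= p) :
  ((Kminus d p)%:E <= Ksharp d p n)%E.
Proof.
case: d hd hn => [|[|d]]// _ _.
(* The direction s of the second flow: 0 if d = 2, and 2 if d >= 3. *)
have [s s1 US] : exists2 s : 'I_d.+2, s != lift ord0 ord0 &
    Num.sqrt (1 - (s == ord0)%:R / 2) = Ucst R d.+2.
  rewrite /Ucst; case: d => [|d].
    exists ord0 => //=; rewrite -sqrtrV ?ler0n//.
    by have -> : 1 - 1 / 2 = 2^-1 :> R by lra.
  by exists (lift ord0 (lift ord0 ord0)); rewrite //= mul0r subr0 sqrtr1.
apply: le_ereal_inf_tmp => _ [K aK <-]; rewrite lee_fin.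
set v := shear ord0 (lift ord0 ord0) : distr R d.+2.
set w := shear (lift ord0 ord0) s : distr R d.+2.
have s0 : lift ord0 ord0 != ord0 :> 'I_d.+2 by [].
have := aK v w (Hsp_shear _ _ _ _ _ s0) (Hsp_shear _ _ _ _ _ s1).
move=> /(le_trans (le_sobolev_Pmap R d p s s1)).
rewrite !sobolev_shear -!EFinM lee_fin US.
rewrite -!expr2 sqr_sqrtr// /Kminus /fnorm powRN; nra.
Qed.
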